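(* Let $\mathcal{M}$ be a constraint hypersurface with degenerate induced form $g^{\mathcal{M}}$, null distribution $\mathcal{N}$, complement $\mathcal{S}$ and constraint-preserving $C^2$ vector field $\mathcal{V}=\mathcal{V}_{\mathcal{N}}+\mathcal{V}_{\mathcal{S}}$ as described in the context. Let $\Psi:\mathcal{M}\to\mathbb{R}$ be a $C^1$ functional, bounded from below, such that $d\Psi(Y)=0$ for all $Y\in\mathcal{N}_X$, $X\in\mathcal{M}$, and $d\Psi(\mathcal{V}_{\mathcal{S}})\le -c\|\mathcal{V}_{\mathcal{S}}\|^2_{\mathcal{S}}$ on $\mathcal{M}$ for some constant $c>0$. Let $\mathcal{Z}=\{X\in\mathcal{M}: d\Psi(\mathcal{V})(X)=0\}$. Then every bounded trajectory $X(t)$, $t\ge 0$, of $\dot X=\mathcal{V}(X)$ with $X(0)=X_0$ satisfies $\omega(X_0)\subseteq\mathcal{Z}$, where $\omega(X_0)$ is the $\omega$-limit set of the trajectory.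
   Context: $\mathcal{U}$ is a smooth $n$-dimensional manifold with a smooth symmetric $(0,2)$-tensor field $g$ of Lorentzian signature $(-,+,\dots,+)$; $\Phi:\mathcal{U}\to\mathbb{R}$ is smooth with $d\Phi\neq 0$ on $\Phi^{-1}(0)$; $\mathcal{M}=\Phi^{-1}(0)$. The restriction $g^{\mathcal{M}}=g|_{T\mathcal{M}\times T\mathcal{M}}$ has constant corank $k\ge 1$; the null distribution is the rank-$k$ subbundle $\mathcal{N}=\ker g^{\mathcal{M}}\subset T\mathcal{M}$, and $\mathcal{S}\subset T\mathcal{M}$ is a fixed smooth complementary subbundle, $T\mathcal{M}=\mathcal{N}\oplus\mathcal{S}$, so that $g^{\mathcal{M}}|_{\mathcal{S}}$ is nondegenerate; $\|\cdot\|_{\mathcal{S}}$ is a smooth norm on $\mathcal{S}$ induced by $g^{\mathcal{M}}|_{\mathcal{S}}$. $\mathcal{V}$ is a $C^2$ vector field on $\mathcal{U}$ with $d\Phi(\mathcal{V})=0$ on $\mathcal{M}$, regarded as a vector field on $\mathcal{M}$, and $\mathcal{V}=\mathcal{V}_{\mathcal{N}}+\mathcal{V}_{\mathcal{S}}$ with $\mathcal{V}_{\mathcal{N}}\in\Gamma(\mathcal{N})$, $\mathcal{V}_{\mathcal{S}}\in\Gamma(\mathcal{S})$. ''Bounded'' refers to a fixed distance on $\mathcal{M}$ inducing its topology. $\omega(X_0)$ is the set of all $Y\in\mathcal{M}$ for which there is a sequence $t_k\to\infty$ with $X(t_k)\to Y$. *)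

(* Defs.v *)
From HB Require Import structures.
From mathcomp Require Import all_boot all_order all_algebra.
From mathcomp Require Import all_classical all_reals all_analysis.
Set Implicit Arguments.
Unset Strict Implicit.
Unset Printing Implicit Defensive.
Import Order.TTheory GRing.Theory Num.Theory.
Import numFieldNormedType.Exports.
Local Open Scope classical_set_scope.
Local Open Scope ring_scope.

(* f is of class C^k on D, meant for D open. *)
Fixpoint Ck_on (R : realType) (E F : normedModType R) (k : nat)
    (f : E -> F) (D : set E) : Prop :=
  match k with
  | 0 => forall x, D x -> {for x, continuous f}
  | k'.+1 => (forall x, D x -> differentiable f x) /\
             (forall v : E, Ck_on k' ('D_v f) D)
  end.

Definition smooth_on (R : realType) (E F : normedModType R)
    (f : E -> F) (D : set E) : Prop := forall k, Ck_on k f D.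

(* A homeomorphism between open sets of U and R^n; both maps are total and
   carry junk values outside [chart_dom] and its image. *)
Record chart (R : realType) (n : nat) (U : topologicalType) := Chart {
  chart_dom : set U;
  chart_map :> U -> 'rV[R]_n;
  chart_inv : 'rV[R]_n -> U;
  open_chart_dom : open chart_dom;
  open_chart_cod : open (chart_map @` chart_dom);
  chart_mapK : forall p, chart_dom p -> chart_inv (chart_map p) = p;
  chart_map_continuous :
    forall p, chart_dom p -> {for p, continuous chart_map};
  chart_inv_continuous :
    forall x, (chart_map @` chart_dom) x -> {for x, continuous chart_inv}
}.

HB.instance Definition _ (R : realType) (n : nat) (U : topologicalType) :=
  gen_eqMixin (chart R n U).
HB.instance Definition _ (R : realType) (n : nat) (U : topologicalType) :=
  gen_choiceMixin (chart R n U).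

Definition chart_cod (R : realType) (n : nat) (U : topologicalType)
  (e : chart R n U) : set 'rV[R]_n := e @` chart_dom e.

Definition smooth_transition (R : realType) (n : nat) (U : topologicalType)
    (e f : chart R n U) : Prop :=
  smooth_on (f \o chart_inv e) (e @` (chart_dom e `&` chart_dom f)).

(* [chart_at p] is a preferred chart around p.  The tangent space T_pU is
   represented throughout by 'rV[R]_n, a tangent vector at p being given by its
   coordinates in the chart [chart_at p].  This choice depends arbitrarily on p,
   so regularity of tensor fields is always tested in a fixed chart. *)
Record smooth_manifold (R : realType) (n : nat) (U : topologicalType) :=
  SmoothManifold {
  manifold_hausdorff : hausdorff_space U;
  manifold_second_countable : @second_countable U;
  atlas : set (chart R n U);
  chart_at : U -> chart R n U;
  atlas_chart_at : forall p, atlas (chart_at p);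
  mem_chart_at : forall p, chart_dom (chart_at p) p;
  atlas_smooth : forall e f, atlas e -> atlas f -> smooth_transition e f
}.

Section Tangent.
Context (R : realType) (n : nat) (U : topologicalType).
Variable A : smooth_manifold R n U.

(* Membership in the maximal smooth atlas. *)
Definition compatible (e : chart R n U) : Prop :=
  forall f, atlas A f -> smooth_transition e f /\ smooth_transition f e.

Definition Ck_fun (F : normedModType R) (k : nat) (f : U -> F) : Prop :=
  forall e, atlas A e -> Ck_on k (f \o chart_inv e) (chart_cod e).

Definition smooth_fun (F : normedModType R) (f : U -> F) : Prop :=
  forall k, Ck_fun k f.

(* The differential df_p : T_pU -> F.  For a compatible chart e around p,
   [tdiff e p v] is the vector of coordinates of v in the chart e. *)
Definition tdiff (F : normedModType R) (f : U -> F) (p : U)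
    (v : 'rV[R]_n) : F :=
  'd (f \o chart_inv (chart_at A p)) (chart_at A p p) v.

(* The tangent vector at p whose coordinates in the chart e are w. *)
Definition tvec (e : chart R n U) (p : U) (w : 'rV[R]_n) : 'rV[R]_n :=
  'd (chart_at A p \o chart_inv e) (e p) w.

Definition Ck_vfield (k : nat) (V : U -> 'rV[R]_n) : Prop :=
  forall e, atlas A e ->
    Ck_on k (fun x => tdiff e (chart_inv e x) (V (chart_inv e x)))
      (chart_cod e).

Definition bilin (G : 'M[R]_n) (v w : 'rV[R]_n) : R := (v *m G *m w^T) 0 0.

Definition smooth_bilin_field (g : U -> 'M[R]_n) : Prop :=
  forall e, atlas A e -> forall w1 w2 : 'rV[R]_n,
    smooth_on (fun x => let p := chart_inv e x in
                        bilin (g p) (tvec e p w1) (tvec e p w2))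
      (chart_cod e).

Definition lorentz_signature (G : 'M[R]_n) : Prop :=
  exists2 P : 'M[R]_n, P \in unitmx &
    P *m G *m P^T = diag_mx (\row_j (if val j == 0%N then -1 else 1)).

Definition lorentz_metric (g : U -> 'M[R]_n) : Prop :=
  [/\ forall p, (g p)^T = g p, smooth_bilin_field g &
      forall p, lorentz_signature (g p)].

(* X'(t) = V(X(t)) for all t >= 0, one-sided at t = 0.  The continuity clause
   keeps X(s) inside the domain of the chart for s close to t. *)
Definition trajectory (V : U -> 'rV[R]_n) (X : R -> U) : Prop :=
  forall t : R, 0 <= t ->
    let e := chart_at A (X t) in
    X s @[s --> within [set s | 0 <= s] (nbhs t)] --> X t /\
    (s - t)^-1 *: (e (X s) - e (X t))
      @[s --> within [set s | 0 <= s /\ s != t] (nbhs t)] --> V (X t).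

(* The row spaces of the following matrices are subspaces of T_pU. *)

(* T_pM = ker dPhi_p for M a regular level set of Phi. *)
Definition tangent_level (Phi : U -> R) (p : U) : 'M[R]_n :=
  kermx (\col_j tdiff Phi p (delta_mx 0 j)).

(* The kernel of the restriction of g_p to T_pM: the v in T_pM such that
   g_p(v, w) = 0 for all w in T_pM. *)
Definition null_space (g : U -> 'M[R]_n) (Phi : U -> R) (p : U) : 'M[R]_n :=
  (tangent_level Phi p :&: kermx (g p *m (tangent_level Phi p)^T))%MS.

End Tangent.

Definition level0 (R : realType) (U : topologicalType) (Phi : U -> R) : set U :=
  [set p | Phi p = 0].

(* The smooth structure of an embedded hypersurface M of U: its charts are
   q |-> slice_proj (e q), for e a chart of the maximal atlas of U in which M is
   the set where the first coordinate vanishes. *)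
Section Hypersurface.
Context (R : realType) (m : nat) (U : topologicalType).
Variables (A : smooth_manifold R m.+1 U) (M : set U).

Definition slice_incl (y : 'rV[R]_m) : 'rV[R]_m.+1 :=
  row_mx (0 : 'rV[R]_1) y.

Definition slice_proj (x : 'rV[R]_m.+1) : 'rV[R]_m :=
  rsubmx (x : 'rV[R]_(1 + m)).

Definition slice_chart (e : chart R m.+1 U) : Prop :=
  compatible A e /\ forall q, chart_dom e q -> (M q <-> e q 0 0 = 0).

Definition slice_cod (e : chart R m.+1 U) : set 'rV[R]_m :=
  [set y | chart_cod e (slice_incl y)].

(* f|_M read in the chart of M induced by the slice chart e. *)
Definition slice_read (F : Type) (f : U -> F) (e : chart R m.+1 U) :
    'rV[R]_m -> F :=
  fun y => f (chart_inv e (slice_incl y)).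

(* f|_M is of class C^k; only the values of f on M matter. *)
Definition Ck_hyper (F : normedModType R) (k : nat) (f : U -> F) : Prop :=
  forall p, M p -> exists e : chart R m.+1 U,
    [/\ slice_chart e, chart_dom e p & Ck_on k (slice_read f e) (slice_cod e)].

(* A slice chart around p; which one is irrelevant. *)
Definition slice_at (p : U) : chart R m.+1 U :=
  xget (chart_at A p) [set e | slice_chart e /\ chart_dom e p].

(* The differential of f|_M at p in M, applied to v in T_pM. *)
Definition hdiff (F : normedModType R) (f : U -> F) (p : U)
    (v : 'rV[R]_m.+1) : F :=
  let e := slice_at p in
  'd (slice_read f e) (slice_proj (e p)) (slice_proj (tdiff A e p v)).

(* Locally around every point of M, the spaces S q have a basis (the rows of
   B q) consisting of smooth vector fields along M. *)
Definition smooth_subbundle (S : U -> 'M[R]_m.+1) : Prop :=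
  forall p, M p ->
    exists (e : chart R m.+1 U) (r : nat) (B : U -> 'M[R]_(r, m.+1)),
    [/\ slice_chart e, chart_dom e p,
        forall q, chart_dom e q -> M q -> row_free (B q) /\ (B q == S q)%MS &
        forall i : 'I_r,
          smooth_on (slice_read (fun q => tdiff A e q (row i (B q))) e)
            (slice_cod e)].

End Hypersurface.

(* d is a distance on M inducing the subspace topology. *)
Definition distance_on (R : realType) (U : topologicalType) (M : set U)
    (d : U -> U -> R) : Prop :=
  [/\ forall p q, M p -> M q -> 0 <= d p q /\ (d p q = 0 <-> p = q),
      forall p q, M p -> M q -> d p q = d q p,
      forall p q r, M p -> M q -> M r -> d p r <= d p q + d q r &
      forall p, M p -> forall B : set U,
        within M (nbhs p) B <->
        exists2 eps : R, 0 < eps & forall q, M q -> d p q < eps -> B q].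

Definition bounded_trajectory (R : realType) (U : topologicalType)
    (d : U -> U -> R) (X : R -> U) : Prop :=
  exists D : R, forall s t, 0 <= s -> 0 <= t -> d (X s) (X t) <= D.

Definition omega_limit (R : realType) (U : topologicalType) (M : set U)
    (X : R -> U) : set U :=
  [set Y | M Y /\ exists t_ : nat -> R,
     t_ k @[k --> \oo] --> +oo /\ X (t_ k) @[k --> \oo] --> Y].

(* The norm induced by g on vectors at p: a genuine norm on S, since g is
   positive definite on any complement of the radical of a degenerate
   hyperplane of a Lorentzian space. *)
Definition induced_norm (R : realType) (n : nat) (U : topologicalType)
    (g : U -> 'M[R]_n) (p : U) (v : 'rV[R]_n) : R :=
  Num.sqrt (bilin (g p) v v).

(* Main.v *)
(* LaSalle's argument. Since dPsi kills N, dPsi(V) = dPsi(V_S) <= 0, so Psi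
   decreases along the trajectory and converges. If dPsi(V) < 0 at a limit point
   Y, then dPsi(V) stays below a negative constant near Y by continuity, and since
   V is bounded near Y each visit to a smaller neighborhood lasts a definite time.
   There are visits at arbitrarily late times, each costing Psi a definite amount:
   a contradiction. Continuity of dPsi(V) and the chain rule are only available in
   a fixed chart, whence the changes of charts: slice charts for Psi and atlas
   charts for V. *)
Require Import Defs.
From HB Require Import structures.
From mathcomp Require Import all_boot all_order all_algebra.
From mathcomp Require Import all_classical all_reals all_analysis.
From mathcomp Require Import lra.
Import Order.TTheory GRing.Theory Num.Theory.
Import numFieldNormedType.Exports.
Local Open Scope classical_set_scope.
Local Open Scope ring_scope.
Set Implicit Arguments.
Unset Strict Implicit.
Unset Printing Implicit Defensive.

(** * Differentials in normed spaces and on row vectors *)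

(** Chart maps have junk values off their domains, so the identities between chart readings used
    below hold only near a point; this carries a differential across them. The first-order expansion
    at [x] is unchanged, and the differential is unique. *)
Lemma is_diff_near (R : numFieldType) (E F : normedModType R) (f g df : E -> F) x :
  is_diff x f df -> (\forall y \near x, f y = g y) -> is_diff x g df.
Proof.
move=> fdf fg; have [fx <-] := fdf.
have gE : g \o shift x = cst (g x) + 'd f x +o_ 0 id.
  apply/eqaddoP => eps eps0.
  have /eqaddoP/(_ eps eps0) := diff_locally fx.
  have fg0 : \forall h \near 0, f (h + x) = g (h + x).
    by move: fg; rewrite (near_shift 0 x) /= subr0.
  apply: filter_app; near=> h => /=.
  by rewrite -(nbhs_singleton fg) !fctE /= (near fg0 h).
have dg : 'd g x = 'd f x :> (E -> F).
  by apply: diff_unique gE; exact: diff_continuous.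
apply: DiffDef => //; apply/diff_locallyP; rewrite dg; split => //.
exact: diff_continuous.
Unshelve. all: by end_near. Qed.

Section RowVectors.
Context {R : realType}.

Lemma linear_rV_continuous n (F : normedModType R) (L : {linear 'rV[R]_n -> F}) :
  continuous L.
Proof.
have -> : (L : _ -> _) = fun v => \sum_j v 0 j *: L (delta_mx 0 j).
  by apply/funext => v; rewrite [in LHS](row_sum_delta v) linear_sum;
     apply: eq_bigr => j _; rewrite linearZ.
move=> v; apply: (cvg_big add_continuous (nbhs_filter v)) => j _.
by apply: cvgZr_tmp; exact: coord_continuous.
Qed.

Lemma is_diff_linear_rV n (F : normedModType R) (L : {linear 'rV[R]_n -> F}) v :
  is_diff v L L.
Proof.
apply: DiffDef; first exact/linear_differentiable/linear_rV_continuous.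
exact/diff_lin/linear_rV_continuous.
Qed.

(* Expanding u in the standard basis reduces joint continuity of 'd G y u to
   the continuity of the partial derivatives. *)
Lemma cvg_diff_C1 n (F : normedModType R) (G : 'rV[R]_n -> F) (D : set 'rV[R]_n)
    (T : Type) (H : set_system T) (FH : Filter H) (y u : T -> 'rV[R]_n) y0 u0 :
  open D -> Ck_on 1 G D -> D y0 ->
  y @ H --> y0 -> u @ H --> u0 ->
  'd G (y t) (u t) @[t --> H] --> 'd G y0 u0.
Proof.
move=> Dop [dG cG] Dy0 yH uH.
have dGE z v : D z -> 'd G z v = \sum_j v 0 j *: 'D_(delta_mx 0 j) G z.
  move=> Dz; rewrite [in LHS](row_sum_delta v) linear_sum; apply: eq_bigr => j _.
  by rewrite linearZ deriveE //; exact: dG.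
have sum_cvg : (fun t => \sum_j u t 0 j *: 'D_(delta_mx 0 j) G (y t)) @ H -->
    \sum_j u0 0 j *: 'D_(delta_mx 0 j) G y0.
  apply: (cvg_big add_continuous FH) => j _.
  have uj : u t 0 j @[t --> H] --> u0 0 j.
    exact: (cvg_comp u (fun x : 'rV[R]_n => x 0 j) uH (@coord_continuous _ _ _ 0 j u0)).
  have yj : 'D_(delta_mx 0 j) G (y t) @[t --> H] --> 'D_(delta_mx 0 j) G y0.
    exact: (cvg_comp y ('D_(delta_mx 0 j) G) yH (cG _ _ Dy0)).
  exact: cvgZ uj yj.
rewrite -(dGE _ u0 Dy0) in sum_cvg; apply: cvg_trans sum_cvg.
have yD : \forall t \near H, D (y t) by exact: yH _ (open_nbhs_nbhs (conj Dop Dy0)).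
by apply: near_eq_cvg; apply: filterS yD => t Dyt /=; rewrite -(dGE _ (u t) Dyt).
Qed.

End RowVectors.

(** * The linear maps between a slice and its ambient coordinate space *)

Section Slices.
Context {R : realType} {m : nat}.

Fact slice_proj_linear : linear (@slice_proj R m).
Proof. by move=> a u v; rewrite /slice_proj linearP. Qed.

HB.instance Definition _ := GRing.isLinear.Build R 'rV[R]_m.+1 'rV[R]_m *:%R
  (@slice_proj R m) slice_proj_linear.

Fact slice_incl_linear : linear (@slice_incl R m).
Proof.
move=> a u v; apply/rowP => j; rewrite /slice_incl !mxE.
by case: splitP => k _; rewrite !mxE ?mulr0 ?addr0.
Qed.

HB.instance Definition _ := GRing.isLinear.Build R 'rV[R]_m 'rV[R]_m.+1 *:%R
  (@slice_incl R m) slice_incl_linear.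

Lemma slice_incl0 (y : 'rV[R]_m) : slice_incl y 0 0 = 0.
Proof.
rewrite /slice_incl (_ : 0 = lshift m 0 :> 'I_(1 + m)); last exact/val_inj.
by rewrite (@row_mxEl _ 1 1 m) mxE.
Qed.

Lemma slice_projK (x : 'rV[R]_m.+1) : x 0 0 = 0 -> slice_incl (slice_proj x) = x.
Proof.
move=> x0; apply/rowP => j; rewrite /slice_incl /slice_proj mxE.
case: splitP => k Ek; rewrite !mxE -?x0; congr (x _ _); apply/val_inj => /=.
  by rewrite Ek ord1.
by rewrite Ek.
Qed.

End Slices.

(** * Changes of charts on the ambient manifold *)

Section Charts.
Context {R : realType} {n : nat} {U : topologicalType}.
Implicit Types e f : chart R n U.

Lemma nbhs_chart_inv e p (B : set U) : chart_dom e p -> nbhs p B ->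
  \forall x \near e p, chart_cod e x /\ B (chart_inv e x).
Proof.
move=> ep pB; have cp : chart_cod e (e p) by exists p.
near=> x; split; near: x.
  exact: open_nbhs_nbhs (conj (open_chart_cod (c:=e)) cp).
by apply: (chart_inv_continuous cp); rewrite chart_mapK.
Unshelve. all: by end_near. Qed.

Lemma chart_codP e x : chart_cod e x ->
  chart_dom e (chart_inv e x) /\ e (chart_inv e x) = x.
Proof. by case=> p ep <-; rewrite chart_mapK. Qed.

Lemma nbhs_chart_dom e p : chart_dom e p -> nbhs p (chart_dom e).
Proof. by move=> ep; apply: open_nbhs_nbhs; split=> //; exact: open_chart_dom. Qed.

Lemma is_diff_chart_change (F : normedModType R) (h : U -> F) e f p :
  chart_dom e p -> chart_dom f p ->
  differentiable (f \o chart_inv e) (e p) ->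
  differentiable (h \o chart_inv f) (f p) ->
  is_diff (e p) (h \o chart_inv e)
    ('d (h \o chart_inv f) (f p) \o 'd (f \o chart_inv e) (e p)).
Proof.
move=> ep fp dfe dhf.
have fE : (f \o chart_inv e) (e p) = f p by rewrite /= chart_mapK.
apply: (@is_diff_near _ _ _ ((h \o chart_inv f) \o (f \o chart_inv e))).
  have := @is_diff_comp _ _ _ _ (f \o chart_inv e) _ (h \o chart_inv f)
    ('d (h \o chart_inv f) (f p)) (e p) (differentiableP dfe).
  by rewrite fE; apply; exact: differentiableP.
have := nbhs_chart_inv ep (nbhs_chart_dom fp).
by apply: filterS => x [_ fx] /=; rewrite chart_mapK.
Qed.

Lemma smooth_transition_differentiable e f p :
  smooth_transition e f -> chart_dom e p -> chart_dom f p ->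
  differentiable (f \o chart_inv e) (e p).
Proof. by move=> /(_ 1%N)[+ _] ep fp; apply; exists p. Qed.

End Charts.

Section ManifoldCharts.
Context {R : realType} {n : nat} {U : topologicalType}.
Variable A : smooth_manifold R n U.
Implicit Types e f : chart R n U.

Lemma compatible_atlas e : atlas A e -> compatible A e.
Proof. by move=> Ae f Af; split; exact: (@atlas_smooth _ _ _ A). Qed.

(** Compatibility is tested only against charts of the atlas, and [e] and [f] may both lie outside
    it, as slice charts may; the transition is therefore factored through the preferred chart at
    [p]. *)
Lemma compatible_differentiable e f p : compatible A e -> compatible A f ->
  chart_dom e p -> chart_dom f p -> differentiable (f \o chart_inv e) (e p).
Proof.
move=> Ce Cf ep fp; have hp := mem_chart_at A p.
have [eh _] := Ce _ (atlas_chart_at A p); have [_ hf] := Cf _ (atlas_chart_at A p).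
have := is_diff_chart_change ep hp (smooth_transition_differentiable eh ep hp)
  (smooth_transition_differentiable hf hp fp).
by case.
Qed.

Lemma tdiff_chart (F : normedModType R) (h : U -> F) e p v :
  compatible A e -> chart_dom e p -> differentiable (h \o chart_inv e) (e p) ->
  tdiff A h p v = 'd (h \o chart_inv e) (e p) (tdiff A e p v).
Proof.
move=> Ce ep dhe; have hp := mem_chart_at A p.
have Ch := compatible_atlas (atlas_chart_at A p).
have [_ E] := is_diff_chart_change hp ep (compatible_differentiable Ch Ce hp ep) dhe.
exact: (congr1 (fun L => L v) E).
Qed.

Lemma smooth_fun_differentiable (F : normedModType R) (h : U -> F) e p :
  smooth_fun A h -> compatible A e -> chart_dom e p ->
  differentiable (h \o chart_inv e) (e p).
Proof.
move=> hh Ce ep; have fp := mem_chart_at A p.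
have Cf := compatible_atlas (atlas_chart_at A p).
have df : differentiable (h \o chart_inv (chart_at A p)) (chart_at A p p).
  by case: (hh 1%N _ (atlas_chart_at A p)) => + _; apply; exists p.
by case: (is_diff_chart_change ep fp (compatible_differentiable Ce Cf ep fp) df).
Qed.

(* A vector field is given by its components in the preferred chart of each
   point, which varies discontinuously; its continuity is only visible in a
   fixed chart. *)
Lemma vfield_chart_continuous (V : U -> 'rV[R]_n) e p :
  Ck_vfield A 0 V -> compatible A e -> chart_dom e p ->
  tdiff A e q (V q) @[q --> p] --> tdiff A e p (V p).
Proof.
move=> hV Ce ep; set f := chart_at A p; have fp : chart_dom f p := mem_chart_at A p.
have Af : atlas A f := atlas_chart_at A p; have Cf := compatible_atlas Af.
have dfe q : chart_dom f q -> chart_dom e q ->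
    differentiable (e \o chart_inv f) (f q).
  exact: compatible_differentiable.
have fcvg : f q @[q --> p] --> f p by exact: chart_map_continuous.
have Vcvg : tdiff A f q (V q) @[q --> p] --> tdiff A f p (V p).
  have cW : (fun x => tdiff A f (chart_inv f x) (V (chart_inv f x))) @ (f p)
      --> tdiff A f p (V p).
    have : chart_cod f (f p) by exists p.
    by move=> /(hV _ Af); rewrite /prop_for /continuous_at chart_mapK.
  have := cvg_comp _ _ fcvg cW; apply: cvg_trans; apply: near_eq_cvg.
  have := nbhs_chart_dom fp; apply: filterS => q fq /=.
  by rewrite chart_mapK.
set D := f @` (chart_dom f `&` chart_dom e).
have Dop : open D.
  rewrite openE => _ [q [fq qe] <-].
  have nq : nbhs q (chart_dom f `&` chart_dom e).
    by apply: filterI; exact: nbhs_chart_dom.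
  apply: filterS (nbhs_chart_inv fq nq) => x [/chart_codP[_ xE] fex].
  by exists (chart_inv f x).
have C1 : Ck_on 1 (e \o chart_inv f) D by have [_] := Ce _ Af; apply.
have Dp : D (f p) by exists p.
have np : nbhs p (chart_dom f `&` chart_dom e).
  by apply: filterI; exact: nbhs_chart_dom.
have near_continuous (k1 k2 : U -> 'rV[R]_n) : (\forall q \near p, k1 q = k2 q) ->
    k1 @ p --> k1 p -> k2 @ p --> k2 p.
  by move=> k12; rewrite (nbhs_singleton k12); apply: cvg_trans; exact: near_eq_cvg.
(* Near [p] the components in [e] come from those in the atlas chart [f] by the differential of the
   transition, which is jointly continuous in the point and the vector. *)
apply: (near_continuous
  (fun q => 'd (e \o chart_inv f) (f q) (tdiff A f q (V q)))).
  by apply: filterS np => q [fq qe]; exact: esym (tdiff_chart (V q) Cf fq (dfe _ fq qe)).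
by have := cvg_diff_C1 (nbhs_filter p) Dop C1 Dp fcvg Vcvg.
Qed.

End ManifoldCharts.

(** * Slice charts and differentials along the hypersurface *)

Section HypersurfaceCharts.
Context {R : realType} {m : nat} {U : topologicalType}.
Variables (A : smooth_manifold R m.+1 U) (M : set U).
Implicit Types e f : chart R m.+1 U.

Lemma open_slice_cod e : open (slice_cod e).
Proof.
have inclc : continuous (@slice_incl R m) by exact: linear_rV_continuous.
by apply: open_comp (@open_chart_cod _ _ _ e) => y _; exact: inclc.
Qed.

Lemma slice_chart_eq0 e p : slice_chart A M e -> M p -> chart_dom e p -> e p 0 0 = 0.
Proof. by move=> [_ eM] Mp ep; apply/eM. Qed.

Lemma slice_chartK e p : slice_chart A M e -> M p -> chart_dom e p ->
  slice_incl (slice_proj (e p)) = e p.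
Proof. by move=> se Mp ep; apply/slice_projK/slice_chart_eq0. Qed.

Lemma nbhs_slice_incl e p (B : set U) : slice_chart A M e -> M p ->
  chart_dom e p -> nbhs p B ->
  \forall y \near slice_proj (e p),
    chart_cod e (slice_incl y) /\ B (chart_inv e (slice_incl y)) /\
    M (chart_inv e (slice_incl y)).
Proof.
move=> se Mp ep pB; have eB := nbhs_chart_inv ep pB.
have : \forall y \near slice_proj (e p),
    chart_cod e (slice_incl y) /\ B (chart_inv e (slice_incl y)).
  have inclc : {for slice_proj (e p), continuous (@slice_incl R m)}.
    exact: linear_rV_continuous.
  rewrite /prop_for /continuous_at (slice_chartK se Mp ep) in inclc.
  exact: inclc _ eB.
apply: filterS => y [cy By]; split=> //; split=> //.
have [dy ey] := chart_codP cy; have [_ /(_ _ dy)[_]] := se; apply.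
by rewrite ey slice_incl0.
Qed.

Lemma is_diff_slice_incl_comp (F : normedModType R) (G : 'rV[R]_m.+1 -> F) e p :
  slice_chart A M e -> M p -> chart_dom e p -> differentiable G (e p) ->
  is_diff (slice_proj (e p)) (G \o @slice_incl R m) ('d G (e p) \o @slice_incl R m).
Proof.
move=> se Mp ep dG.
apply: is_diff_comp; first exact: is_diff_linear_rV.
by rewrite (slice_chartK se Mp ep); exact: differentiableP.
Qed.

(** The transition sends slice points of [f] to points of M, where the first coordinate of [e]
    vanishes, so projecting loses nothing. The chain rule thus applies with only the restriction of
    [h] to M known to be differentiable. *)
Lemma is_diff_slice_change (F : normedModType R) (h : U -> F) e f p :
  slice_chart A M e -> slice_chart A M f -> M p -> chart_dom e p -> chart_dom f p ->
  differentiable (slice_read h e) (slice_proj (e p)) ->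
  is_diff (slice_proj (f p)) (slice_read h f)
    ('d (slice_read h e) (slice_proj (e p)) \o
      (@slice_proj R m \o ('d (e \o chart_inv f) (f p) \o @slice_incl R m))).
Proof.
move=> se sf Mp ep fp dh; have [Ce _] := se; have [Cf _] := sf.
have dfe := compatible_differentiable Cf Ce fp ep.
have is1 := is_diff_slice_incl_comp sf Mp fp dfe.
set tau := (e \o chart_inv f) \o @slice_incl R m in is1.
have tauE : tau (slice_proj (f p)) = e p.
  by rewrite /tau /= (slice_chartK sf Mp fp) chart_mapK.
have is2 := is_diff_comp is1 (is_diff_linear_rV (@slice_proj R m) _).
have is3 : is_diff ((@slice_proj R m \o tau) (slice_proj (f p))) (slice_read h e)
    ('d (slice_read h e) (slice_proj (e p))).
  by rewrite /= tauE; exact: differentiableP.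
have is4 := is_diff_comp is2 is3.
apply: is_diff_near is4 _.
apply: filterS (nbhs_slice_incl sf Mp fp (nbhs_chart_dom ep)) => y [_ [ey My]].
by rewrite /slice_read /tau /= (slice_chartK se My ey) chart_mapK.
Qed.

(** Independence of the chart picked by [slice_at]. The first coordinate of [v] has to vanish in
    slice charts: [slice_proj] discards it, and a change of slice charts could otherwise feed it
    into the remaining coordinates. *)
Lemma hdiff_chart (F : normedModType R) (h : U -> F) e p v :
  slice_chart A M e -> M p -> chart_dom e p ->
  differentiable (slice_read h e) (slice_proj (e p)) ->
  (forall f, slice_chart A M f -> chart_dom f p -> tdiff A f p v 0 0 = 0) ->
  hdiff A M h p v =
    'd (slice_read h e) (slice_proj (e p)) (slice_proj (tdiff A e p v)).
Proof.
move=> se Mp ep dh tv; rewrite /hdiff; set f := slice_at A M p.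
have [sf fp] : slice_chart A M f /\ chart_dom f p.
  exact: (@xgetPex _ _ [set e | slice_chart A M e /\ chart_dom e p]
    (ex_intro _ e (conj se ep))).
have [Ce _] := se; have [Cf _] := sf.
have [_ E] := is_diff_slice_change se sf Mp ep fp dh.
have {}E := congr1 (fun L => L (slice_proj (tdiff A f p v))) E.
apply: (etrans E) => /=; congr ('d _ _ (slice_proj _)).
rewrite slice_projK ?tv //; apply/esym/tdiff_chart => //.
exact: compatible_differentiable Cf Ce fp ep.
Qed.

End HypersurfaceCharts.

(** In a slice chart Phi vanishes on the hyperplane of zero first coordinate, so its differential is
    a multiple of the first coordinate, with nonzero factor by regularity; its kernel is then that
    hyperplane. *)
Lemma slice_chart_tangent (R : realType) (m : nat) (U : topologicalType)
    (A : smooth_manifold R m.+1 U) (Phi : U -> R) (f : chart R m.+1 U) p v :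
  smooth_fun A Phi -> level0 Phi p ->
  (exists u, tdiff A Phi p u != 0) -> tdiff A Phi p v = 0 ->
  slice_chart A (level0 Phi) f -> chart_dom f p -> tdiff A f p v 0 0 = 0.
Proof.
move=> hPhi Mp [u uneq0] v0 sf fp; have [Cf _] := sf.
have dPhi := smooth_fun_differentiable hPhi Cf fp.
set L := 'd (Phi \o chart_inv f) (f p) in dPhi *.
have tE w : tdiff A Phi p w = L (tdiff A f p w) by exact: tdiff_chart.
(* Read on the slice, Phi is zero near the coordinates of [p], so its differential there is that of
   a constant. *)
have L0 y : L (slice_incl y) = 0.
  have is0 := is_diff_slice_incl_comp sf Mp fp dPhi.
  have is1 : is_diff (slice_proj (f p)) (cst (0 : R)) (L \o @slice_incl R m).
    apply: is_diff_near is0 _.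
    by apply: filterS (nbhs_slice_incl sf Mp fp filterT) => z [_ [_]].
  have [_ E1] := is1; have [_ E2] := is_diff_cst (0 : R) (slice_proj (f p)).
  exact: (congr1 (fun k => k y) (etrans (esym E1) E2)).
pose b : 'rV[R]_m.+1 := delta_mx 0 0.
have LE w : L w = w 0 0 * L b.
  have wE : w = w 0 0 *: b + slice_incl (slice_proj (w - w 0 0 *: b)).
    by rewrite slice_projK ?subrKC // !mxE eqxx mulr1 subrr.
  by rewrite [in LHS]wE linearD linearZ /= L0 addr0.
have Lb0 : L b != 0.
  by apply: contra_neq uneq0; move=> Lb; rewrite tE LE Lb mulr0.
by move/eqP: v0; rewrite tE LE mulf_eq0 (negbTE Lb0) orbF => /eqP.
Qed.

(** * Mean value inequalities *)

Section MeanValue.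
Context {R : realType}.

(** [C] may be negative, which later turns a strictly negative derivative into a definite drop of
    Psi. *)
Lemma mean_value_le (f : R -> R) (a b C : R) : a <= b ->
  (forall t, a <= t <= b -> differentiable f t /\ 'd f t 1 <= C) ->
  f b - f a <= C * (b - a).
Proof.
move=> ab df.
have is_df t : t \in `]a, b[ -> is_derive t 1 f ('d f t 1).
  rewrite in_itv => /= /andP[/ltW at_ /ltW tb].
  have [dft _] := df t (introT andP (conj at_ tb)).
  by rewrite -deriveE //; exact/derivableP/diff_derivable.
have cf : {within `[a, b], continuous f}.
  by apply: derivable_within_continuous => t /df[dft _]; exact: diff_derivable.
have [s sab ->] := MVT_segment ab is_df cf.
by rewrite ler_wpM2r ?subr_ge0 //; have [] := df _ sab.
Qed.

Lemma mx_norm_le n (x : 'rV[R]_n) (C : R) : 0 <= C ->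
  (forall i, `|x 0 i| <= C) -> `|x| <= C.
Proof.
move=> C0 xC; rewrite [`|x|]mx_normrE; apply/bigmax_leP; split=> // -[i j] _ /=.
by rewrite ord1.
Qed.

Lemma le_coord_mx_norm n (x : 'rV[R]_n) i : `|x 0 i| <= `|x|.
Proof.
rewrite [leRHS]mx_normrE.
exact: (@le_bigmax _ _ _ _ (fun ij => `|x ij.1 ij.2|) (0, i)).
Qed.

(** The norm is the largest absolute value of a coordinate, so the scalar inequality is applied to
    each coordinate and to its opposite. *)
Lemma mean_value_norm n (f : R -> 'rV[R]_n) (a b C : R) : a <= b -> 0 <= C ->
  (forall t, a <= t <= b -> differentiable f t /\ `|'d f t 1| <= C) ->
  `|f b - f a| <= C * (b - a).
Proof.
move=> ab C0 df; apply: mx_norm_le => [|i]; first by rewrite mulr_ge0 ?subr_ge0.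
pose L (x : 'rV[R]_n) : R := x 0 i.
have linL : linear L by move=> k u v; rewrite /L !mxE.
pose Ll : {linear 'rV[R]_n -> R} := HB.pack L (GRing.isLinear.Build _ _ _ _ _ linL).
have dL t : a <= t <= b ->
    differentiable (Ll \o f) t /\ 'd (Ll \o f) t 1 = L ('d f t 1).
  move=> /df[dft _].
  have [? E] := is_diff_comp (differentiableP dft) (is_diff_linear_rV Ll (f t)).
  by have := congr1 (fun k => k 1) E.
have LC t : a <= t <= b -> `|L ('d f t 1)| <= C.
  by move=> /df[_]; apply: le_trans; exact: le_coord_mx_norm.
have up : L (f b) - L (f a) <= C * (b - a).
  apply: (@mean_value_le (Ll \o f)) => // t tab; have [? ->] := dL t tab.
  by split=> //; apply: le_trans (LC t tab); exact: ler_norm.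
have dn : L (f a) - L (f b) <= C * (b - a).
  have := @mean_value_le (- (Ll \o f)) a b C ab; rewrite /= opprK addrC; apply.
  move=> t tab; have [? E] := dL t tab.
  have [? EN] := is_diffN (differentiableP (dL t tab).1).
  split=> //; rewrite (congr1 (fun k => k 1) EN) fctE E.
  by apply: le_trans (LC t tab); rewrite -normrN; exact: ler_norm.
by rewrite !mxE ler_norml up andbT lerNl opprB.
Qed.

End MeanValue.

(** * Trajectories: derivatives in charts and confinement near a point *)

Section Trajectories.
Context {R : realType} {n : nat} {U : topologicalType}.
Variables (A : smooth_manifold R n U) (V : U -> 'rV[R]_n) (X : R -> U).
Hypothesis hX : trajectory A V X.

(** For [t > 0] the constraint [0 <= s] holds near [t], so the limit within the half-line is an
    ordinary one. This is why the arguments below run over positive times. *)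
Lemma trajectory_continuous (t : R) : 0 < t -> X @ t --> X t.
Proof.
move=> t0; have [Xt _] := hX (ltW t0); move=> B XB.
have ge0 : \forall s \near t, 0 <= s.
  by near=> s; apply: ltW; near: s; exact: lt_nbhsr.
have := Xt _ XB; rewrite /= /within /= => Bs.
by apply: filterS2 ge0 Bs => s s0; exact.
Unshelve. all: by end_near. Qed.

Lemma trajectory_derive (t : R) : 0 < t ->
  let e := chart_at A (X t) in is_derive t 1 (e \o X) (V (X t)).
Proof.
move=> t0 e; have [_ lim_t] := hX (ltW t0).
suff lim0 : h^-1 *: (((e \o X) \o shift t) (h *: 1) - (e \o X) t) @[h --> 0^'] -->
    V (X t).
  by apply: DeriveDef; [apply/cvg_ex; exists (V (X t)) | exact: cvg_lim].
have shift_cvg : h + t @[h --> 0^'] -->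
    within [set s | 0 <= s /\ s != t] (nbhs t).
  move=> B; rewrite /= /within /= => tB.
  have ge0 : \forall s \near t, 0 <= s.
    by near=> s; apply: ltW; near: s; exact: lt_nbhsr.
  have : \forall h \near 0, (h != 0 -> B (h + t)).
    rewrite (near_shift t 0) /= sub0r; apply: filterS2 ge0 tB => s s0 Bs.
    by move=> sNt; rewrite subrK; apply: Bs; rewrite -subr_eq0.
  by [].
have := cvg_comp _ _ shift_cvg lim_t; apply: cvg_trans.
apply: near_eq_cvg; near=> h.
by rewrite /= addrK [h%:A]mulr1.
Unshelve. all: by end_near. Qed.

(** The velocity condition is stated in the preferred chart at [X t]; composing with the transition
    to [e] gives the velocity in a chart that can be kept fixed as [t] varies. *)
Lemma trajectory_chart_diff e (t : R) : compatible A e -> 0 < t -> chart_dom e (X t) ->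
  differentiable (e \o X) t /\
  'd (e \o X) t 1 = tdiff A e (X t) (V (X t)).
Proof.
move=> Ce t0 et; set f := chart_at A (X t).
have ft : chart_dom f (X t) := mem_chart_at A (X t).
have Cf : compatible A f := compatible_atlas (atlas_chart_at A (X t)).
have [dfX DfX] := trajectory_derive t0.
have {}dfX : differentiable (f \o X) t by exact/derivable1_diffP.
rewrite deriveE // in DfX.
have is0 := is_diff_comp (differentiableP dfX)
  (differentiableP (compatible_differentiable Cf Ce ft et)).
have is1 : is_diff t (e \o X) ('d (e \o chart_inv f) (f (X t)) \o 'd (f \o X) t).
  apply: is_diff_near is0 _.
  have : \forall s \near t, chart_dom f (X s).
    exact: trajectory_continuous t0 _ (nbhs_chart_dom ft).
  by apply: filterS => s fs; rewrite /= chart_mapK.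
have [dE E] := is1; split=> //.
have {}E := congr1 (fun k => k 1) E.
by apply: (etrans E); rewrite /= DfX.
Qed.

End Trajectories.

(** [h] is controlled only along M. As the curve stays in M, near [t] the function [h \o X] factors
    through the slice coordinates of [e], where the chain rule applies. *)
Lemma trajectory_hyper_diff (R : realType) (m : nat) (U : topologicalType)
    (A : smooth_manifold R m.+1 U) (V : U -> 'rV[R]_m.+1) (X : R -> U)
    (M : set U) (h : U -> R) (e : chart R m.+1 U) (t : R) :
  trajectory A V X -> (forall s, 0 <= s -> M (X s)) -> 0 < t ->
  slice_chart A M e -> chart_dom e (X t) ->
  differentiable (slice_read h e) (slice_proj (e (X t))) ->
  differentiable (h \o X) t /\
  'd (h \o X) t 1 = 'd (slice_read h e) (slice_proj (e (X t)))
    (slice_proj (tdiff A e (X t) (V (X t)))).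
Proof.
move=> hX XM t0 se et dh; have [Ce _] := se.
have [deX DeX] := trajectory_chart_diff hX Ce t0 et.
have is0 := is_diff_comp (differentiableP deX)
  (is_diff_linear_rV (@slice_proj R m) (e (X t))).
have is1 := is_diff_comp is0 (differentiableP dh).
have : is_diff t (h \o X) ('d (slice_read h e) (slice_proj (e (X t))) \o
    (@slice_proj R m \o 'd (e \o X) t)).
  apply: is_diff_near is1 _.
  have et_near : \forall s \near t, chart_dom e (X s).
    have Xc := trajectory_continuous hX t0; exact: Xc _ (nbhs_chart_dom et).
  have ge0 : \forall s \near t, 0 <= s.
    by near=> s; apply: ltW; near: s; exact: lt_nbhsr.
  apply: filterS2 et_near ge0 => s es s0.
  by rewrite /slice_read /= (slice_chartK se (XM s s0) es) chart_mapK.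
case=> dE E; split=> //.
have {}E := congr1 (fun k => k 1) E.
by apply: (etrans E); rewrite /= DeX.
Unshelve. all: by end_near. Qed.

(* The curve cannot leave N through the compact, hence closed, preimage of a
   closed chart ball before time r / (2 K). *)
Lemma chart_speed_bound_trap (R : realType) (n : nat) (U : topologicalType)
    (X : R -> U) (e : chart R n U) (N : set U) (Y : U) (K : R) :
  hausdorff_space U -> chart_dom e Y -> nbhs Y N -> 0 < K ->
  (forall t : R, 0 < t -> X @ t --> X t) ->
  (forall t : R, 0 < t -> chart_dom e (X t) -> N (X t) ->
     differentiable (e \o X) t /\ `|'d (e \o X) t 1| <= K) ->
  exists N0 : set U, nbhs Y N0 /\ exists2 tau : R, 0 < tau &
    forall t, 0 < t -> N0 (X t) ->
    forall s, t <= s <= t + tau -> chart_dom e (X s) /\ N (X s).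
Proof.
move=> hausU eY YN K0 Xc dX.
have /nbhs_ballP[rho rho0 rhoP] := nbhs_chart_inv eY YN.
have {}rho0 : 0 < rho := rho0.
set r := rho / 2; have r0 : 0 < r by rewrite divr_gt0.
pose Cb : set 'rV[R]_n := closed_ball (e Y) r.
have CbE x : Cb x <-> `|e Y - x| <= r by rewrite /Cb closed_ballE.
have CbP x : Cb x -> chart_cod e x /\ N (chart_inv e x).
  move=> /CbE xr; apply: rhoP; rewrite -ball_normE /=.
  by apply: le_lt_trans xr _; rewrite /r; lra.
pose C := chart_inv e @` Cb.
have Ccl : closed C.
  apply: compact_closed hausU _; apply: continuous_compact.
    apply: continuous_in_subspaceT => x /set_mem /CbP[cx _].
    exact: chart_inv_continuous.
  apply: bounded_closed_compact; last exact: closed_ball_closed.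
  exists (`|e Y| + r); split; first exact: num_real.
  move=> M' ltM x /CbE xr; apply: ltW; apply: le_lt_trans ltM.
  have -> : x = e Y - (e Y - x) by rewrite subKr.
  by apply: le_trans (ler_normB _ _) _; rewrite lerD2l.
have CP p : C p -> chart_dom e p /\ N p.
  by case=> x /CbP[/chart_codP[? _] ?] <-.
pose B d := [set p | chart_dom e p /\ `|e Y - e p| < d].
have BC p : B r p -> C p.
  by move=> [ep /ltW epr]; exists (e p); [exact/CbE | exact: chart_mapK].
have Bnbhs d p : B d p -> nbhs p (B d).
  move=> [ep epd]; apply: filterI; first exact: nbhs_chart_dom.
  have ec : e @ p --> e p by exact: chart_map_continuous.
  have : nbhs (e p) [set x | `|e Y - x| < d].
    have := @ball_open _ _ (e Y) d; rewrite -ball_normE => bop.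
    by apply: open_nbhs_nbhs; split.
  exact: ec.
(* Starting within [r / 2] of the centre leaves a margin of [r / 2], which cannot be crossed in time
   [tau] at chart speed at most [K]. *)
exists (B (r / 2)); split.
  by apply: Bnbhs; split=> //; rewrite subrr normr0 divr_gt0.
exists (r / 2 / K) => [|t t0 Bt]; first by rewrite !divr_gt0.
set tau := r / 2 / K; have tauK : K * tau = r / 2 by rewrite mulrC divfK ?gt_eqF.
have Ct : C (X t) by apply: BC; case: Bt => et d; split=> //; lra.
suff stay s : t <= s <= t + tau -> C (X s) by move=> s /stay /CP.
move=> sP; apply: contrapT => nCs.
(* First-exit argument: at the infimum [sg] of the bad times the curve is in [C] by closedness, then
   strictly inside by the speed bound, hence still inside shortly after [sg], where bad times should
   occur. *)
pose bad := [set u | t <= u <= t + tau /\ ~ C (X u)].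
have lb_bad : lbound bad t by move=> u [/andP[]].
have bads : bad s by [].
have infbad : has_inf bad by split; [exists s | exists t].
set sg := inf bad.
have tsg : t <= sg by apply: lb_le_inf => //; exists s.
have sgs : sg <= s by apply: ge_inf => //; exists t.
have sg0 : 0 < sg by exact: lt_le_trans tsg.
have sgtau : sg <= t + tau by case/andP: sP => _; exact: le_trans.
have before u : t <= u -> u < sg -> C (X u).
  move=> tu us; apply: contrapT => nCu.
  have /(ge_inf (ex_intro _ t lb_bad)) : bad u.
    by split=> //; rewrite tu (le_trans (ltW us)).
  by rewrite leNgt us.
(* Otherwise the curve would avoid [C] on an interval around [sg], against [before]; the time tested
   is [sg - d / 2], or [t] when that falls before [t]. *)
have Csg : C (X sg).
  have [->//|tNsg] := eqVneq sg t.
  have {tNsg} t_lt : t < sg by rewrite lt_neqAle eq_sym tNsg.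
  apply: contrapT => nCsg.
  have /nbhs_ballP[d d0 dP] : \forall u \near sg, ~ C (X u).
    have nC : nbhs (X sg) (~` C).
      by apply: open_nbhs_nbhs; split=> //; exact: closed_openC.
    exact: (Xc sg sg0 _ nC).
  have {}d0 : 0 < d := d0.
  have [tu|ut] := leP t (sg - d / 2).
    have : ball sg d (sg - d / 2).
      by rewrite -ball_normE /= subKr gtr0_norm; lra.
    by move/dP; apply; apply: before => //; lra.
  have : ball sg d t by rewrite -ball_normE /= gtr0_norm; lra.
  by move/dP; apply; exact: before.
have upto u : t <= u <= sg -> C (X u).
  move=> /andP[tu]; rewrite le_eqVlt => /predU1P[-> //|]; exact: before.
have mv : `|e (X sg) - e (X t)| <= K * (sg - t).
  apply: (@mean_value_norm _ _ (e \o X)) => [//||u ut]; first exact: ltW.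
  have [eu Nu] := CP _ (upto u ut); apply: dX => //.
  by case/andP: ut => tu _; exact: lt_le_trans tu.
have Bsg : B r (X sg).
  have [esg _] := CP _ Csg; split=> //; have [_ Bt2] := Bt.
  have -> : e Y - e (X sg) = (e Y - e (X t)) - (e (X sg) - e (X t)).
    by rewrite opprB addrA subrK.
  apply: le_lt_trans (ler_normB _ _) _.
  have : K * (sg - t) <= K * tau by apply: ler_wpM2l; [exact: ltW | rewrite lerBlDl].
  by rewrite tauK; lra.
have /nbhs_ballP[d d0 dP] : \forall u \near sg, B r (X u).
  exact: (Xc sg sg0 _ (Bnbhs _ _ Bsg)).
have [u badu usg] := inf_adherent d0 infbad.
have sgu : sg <= u by apply: ge_inf => //; exists t.
case: badu => _; apply; apply: BC; apply: dP; rewrite -ball_normE /=.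
by rewrite distrC ger0_norm ?subr_ge0 // ltrBlDl.
Qed.

(** * LaSalle's argument on the hypersurface *)

Lemma Ck_vfieldW (R : realType) (n : nat) (U : topologicalType)
    (A : smooth_manifold R n U) (V : U -> 'rV[R]_n) k :
  Ck_vfield A k.+1 V -> Ck_vfield A 0 V.
Proof.
by move=> hV e Ae x ex; apply: differentiable_continuous; apply: (hV e Ae).1.
Qed.

Lemma hdiffD (R : realType) (m : nat) (U : topologicalType)
    (A : smooth_manifold R m.+1 U) (M : set U) (F : normedModType R) (h : U -> F) p u v :
  hdiff A M h p (u + v) = hdiff A M h p u + hdiff A M h p v.
Proof. by rewrite /hdiff /tdiff !linearD. Qed.

(* The strict decrease at a point Y of the limit set persists on a neighborhood
   of Y in which every visit of the trajectory lasts a definite time. *)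
Lemma lasalle_hypersurface (R : realType) (m : nat) (U : topologicalType)
    (A : smooth_manifold R m.+1 U) (Phi : U -> R) (V : U -> 'rV[R]_m.+1)
    (Psi : U -> R) (X : R -> U) (b : R) :
  smooth_fun A Phi ->
  (forall p, level0 Phi p -> exists v, tdiff A Phi p v != 0) ->
  Ck_vfield A 0 V -> (forall p, level0 Phi p -> tdiff A Phi p (V p) = 0) ->
  Ck_hyper A (level0 Phi) 1 Psi -> (forall p, level0 Phi p -> b <= Psi p) ->
  (forall p, level0 Phi p -> hdiff A (level0 Phi) Psi p (V p) <= 0) ->
  trajectory A V X -> (forall t : R, 0 <= t -> level0 Phi (X t)) ->
  omega_limit (level0 Phi) X `<=`
    [set p | level0 Phi p /\ hdiff A (level0 Phi) Psi p (V p) = 0].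
Proof.
set M := level0 Phi => hPhi hreg hV Vtan hPsi Psib hd0 hX XM Y [MY [t_ [t_oo Xt_Y]]].
split=> //; pose hd p : R := hdiff A M Psi p (V p).
have tan p f : M p -> slice_chart A M f -> chart_dom f p -> tdiff A f p (V p) 0 0 = 0.
  by move=> Mp; apply: slice_chart_tangent => //; [exact: hreg | exact: Vtan].
have cod e p : slice_chart A M e -> M p -> chart_dom e p ->
    slice_cod e (slice_proj (e p)).
  by move=> se Mp ep; rewrite /slice_cod /= (slice_chartK se Mp ep); exists p.
have dPsiX (t : R) : 0 < t -> differentiable (Psi \o X) t /\ 'd (Psi \o X) t 1 = hd (X t).
  move=> t0; have MXt : M (X t) := XM t (ltW t0).
  have [e [se et [dpsi _]]] := hPsi _ MXt.
  have dP := dpsi _ (cod _ _ se MXt et).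
  have [dPX E] := trajectory_hyper_diff hX XM t0 se et dP.
  have hE : hd (X t) = _ := hdiff_chart se MXt et dP (fun f => tan _ f MXt).
  by split; [exact: dPX | rewrite hE; exact: E].
have Psi_nincr (s t : R) : 0 < s -> s <= t -> Psi (X t) <= Psi (X s).
  move=> s0 st; rewrite -subr_le0.
  have := @mean_value_le _ (Psi \o X) s t 0 st; rewrite mul0r; apply.
  move=> u /andP[su _]; have u0 := lt_le_trans s0 su.
  have [dPX E] := dPsiX u u0; split; first exact: dPX.
  exact: (eq_ind_r (fun y : R => y <= 0) (hd0 _ (XM _ (ltW u0))) E).
have half_neg (a : R) : a < 0 -> a < a / 2 /\ a / 2 < 0 by clear => a0; lra.
apply: contrapT => /eqP; rewrite -/(hd Y) => hdY.
have {}hdY : hd Y < 0 by rewrite lt_neqAle hdY; exact: hd0.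
have [hdY_half half0] := half_neg _ hdY.
have [e [se eY C1psi]] := hPsi _ MY; have [Ce _] := se; have [dpsi _] := C1psi.
(* [hd] is defined with a slice chart chosen separately at each point, which hides its continuity;
   [D] is its reading in the single chart [e], continuous at [Y] and equal to [hd] there. *)
pose W q := tdiff A e q (V q).
pose D q : R := 'd (slice_read Psi e) (slice_proj (e q)) (slice_proj (W q)).
have Wc : W @ Y --> W Y by exact: vfield_chart_continuous.
have projc x : {for x, continuous (@slice_proj R m)} by exact: linear_rV_continuous.
have ec : e q @[q --> Y] --> e Y by exact: chart_map_continuous.
have Dc : D @ Y --> D Y.
  have pe := cvg_comp _ _ ec (projc (e Y)).
  have pW := cvg_comp _ _ Wc (projc (W Y)).
  by have := cvg_diff_C1 (nbhs_filter Y) (@open_slice_cod _ _ _ e) C1psi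
    (cod _ _ se MY eY) pe pW.
have DY : D Y = hd Y.
  have dY := dpsi _ (cod _ _ se MY eY).
  have hE : hd Y = _ := hdiff_chart se MY eY dY (fun f => tan _ f MY).
  rewrite hE /D; reflexivity.
pose K := `|W Y| + 1.
have K0 : 0 < K by rewrite /K ltr_pwDr.
(* The first condition feeds the trapping lemma, the second the drop of Psi; both hold strictly at
   [Y], hence near it. *)
pose N := [set q | `|W q| < K /\ D q < hd Y / 2].
have YN : nbhs Y N.
  apply: filterI.
    have nW := cvg_norm Wc.
    have : nbhs `|W Y| [set x | x < K] by apply: lt_nbhsl; rewrite /K ltrDl.
    exact: nW.
  have DYlt : D Y < hd Y / 2.
    exact: (eq_ind_r (fun y => y < hd Y / 2) hdY_half DY).
  have : nbhs (D Y) [set x | x < hd Y / 2] by exact: lt_nbhsl.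
  exact: Dc.
have Xc (t : R) : 0 < t -> X @ t --> X t by exact: (trajectory_continuous hX).
have speed (t : R) : 0 < t -> chart_dom e (X t) -> N (X t) ->
    differentiable (e \o X) t /\ `|'d (e \o X) t 1| <= K.
  move=> t0 et [/ltW WK _]; have [deX E] := trajectory_chart_diff hX Ce t0 et.
  by split; [exact: deX | exact: (eq_ind_r (fun y : 'rV[R]_m.+1 => `|y| <= K) WK E)].
have [N0 [YN0 [tau tau0 trap]]] :=
  chart_speed_bound_trap (manifold_hausdorff A) eY YN K0 Xc speed.
(* The infimum of Psi along the curve plays the role of its limit; only positive times enter, where
   Psi is differentiated. *)
pose E := [set Psi (X t) | t in [set t : R | 0 < t]].
have lbE : lbound E b by move=> _ [t /= t0 <-]; exact/Psib/XM/ltW.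
have infE : has_inf E by split; [exists (Psi (X 1)), 1 => //=; exact: ltr01 | exists b].
have drop0 : 0 < - (hd Y / 2) * tau.
  by apply: mulr_gt0 tau0; rewrite oppr_gt0.
(* From [T] on, Psi exceeds its infimum by less than the cost of one visit, so a single visit after
   [T] gives the contradiction. *)
have [_ [T /= T0 <-] PsiT] := inf_adherent drop0 infE.
have [k [Tk Nk]] : exists k, T < t_ k /\ N0 (X (t_ k)).
  have nT : \forall k \near \oo, T < t_ k.
    by exact: (t_oo _ (nbhs_pinfty_gt (num_real T))).
  have nN : \forall k \near \oo, N0 (X (t_ k)) by exact: (Xt_Y _ YN0).
  exact: filter_ex (filterI nT nN).
have tk0 : 0 < t_ k by exact: lt_trans Tk.
have tk_tau : t_ k <= t_ k + tau by rewrite lerDl ltW.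
have := @mean_value_le _ (Psi \o X) (t_ k) (t_ k + tau) (hd Y / 2) tk_tau.
have -> : t_ k + tau - t_ k = tau by rewrite addrC addKr.
move=> /(_ _) drop.
have {}drop : Psi (X (t_ k + tau)) - Psi (X (t_ k)) <= hd Y / 2 * tau.
  apply: drop => t tP; have [et [_ Dt]] := trap _ tk0 Nk t tP.
  have t0 : 0 < t by case/andP: tP => tkt _; exact: lt_le_trans tkt.
  have dP := dpsi _ (cod _ _ se (XM t (ltW t0)) et).
  have [dPX DE] := trajectory_hyper_diff hX XM t0 se et dP.
  by split; [exact: dPX | exact: (eq_ind_r (fun y : R => y <= hd Y / 2) (ltW Dt) DE)].
have low : inf E <= Psi (X (t_ k + tau)).
  apply: ge_inf; first by exists b.
  by exists (t_ k + tau); [exact: addr_gt0 | ].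
have mono := Psi_nincr _ _ T0 (ltW Tk).
(* [Psi (X (t_ k + tau)) <= Psi (X (t_ k)) + hd Y / 2 * tau <= Psi (X T) + hd Y / 2 * tau < inf E],
   against [low]. *)
rewrite mulNr in PsiT; move: drop low mono PsiT; clear.
move: (hd Y / 2 * tau) (inf E) (Psi (X (t_ k + tau))) (Psi (X (t_ k))) (Psi (X T)).
by move=> h L p q r; lra.
Qed.

Theorem proposition3p3 (R : realType) (m : nat) (U : topologicalType)
  (A : smooth_manifold R m.+1 U)
  (g : U -> 'M[R]_m.+1) (hg : lorentz_metric A g)
  (Phi : U -> R) (hPhi : smooth_fun A Phi)
  (hreg : forall p, level0 Phi p -> exists v : 'rV[R]_m.+1, tdiff A Phi p v != 0)
  (k : nat) (hk : (1 <= k)%N)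
  (hcorank : forall p, level0 Phi p -> \rank (null_space A g Phi p) = k)
  (S : U -> 'M[R]_m.+1) (hS : smooth_subbundle A (level0 Phi) S)
  (hNS : forall p, level0 Phi p ->
     (null_space A g Phi p + S p == tangent_level A Phi p)%MS /\
     (null_space A g Phi p :&: S p)%MS = 0)
  (V : U -> 'rV[R]_m.+1) (hV : Ck_vfield A 2 V)
  (hVtan : forall p, level0 Phi p -> tdiff A Phi p (V p) = 0)
  (VN VS : U -> 'rV[R]_m.+1)
  (hVdec : forall p, level0 Phi p -> V p = VN p + VS p)
  (hVN : forall p, level0 Phi p -> (VN p <= null_space A g Phi p)%MS)
  (hVS : forall p, level0 Phi p -> (VS p <= S p)%MS)
  (dist : U -> U -> R) (hdist : distance_on (level0 Phi) dist)
  (Psi : U -> R) (hPsi : Ck_hyper A (level0 Phi) 1 Psi)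
  (hPsi_lb : exists b : R, forall p, level0 Phi p -> b <= Psi p)
  (hPsiN : forall p, level0 Phi p -> forall Y : 'rV[R]_m.+1,
     (Y <= null_space A g Phi p)%MS -> hdiff A (level0 Phi) Psi p Y = 0)
  (c : R) (hc : 0 < c)
  (hPsiS : forall p, level0 Phi p ->
     hdiff A (level0 Phi) Psi p (VS p) <= - c * induced_norm g p (VS p) ^+ 2)
  (X0 : U) (X : R -> U) (hX0 : X 0 = X0)
  (hXM : forall t, 0 <= t -> level0 Phi (X t))
  (hX : trajectory A V X) (hXbd : bounded_trajectory dist X) :
  omega_limit (level0 Phi) X `<=`
    [set p | level0 Phi p /\ hdiff A (level0 Phi) Psi p (V p) = 0].
Proof.
have [b Psib] := hPsi_lb.
apply: (lasalle_hypersurface hPhi hreg (Ck_vfieldW hV) hVtan hPsi Psib _ hX hXM).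
(* By additivity of the differential, the null part of V contributes zero and the remaining part is
   bounded by a nonpositive dissipation term. *)
move=> p Mp; rewrite hVdec // hdiffD hPsiN ?hVN // add0r.
apply: le_trans (hPsiS _ Mp) _.
by rewrite mulNr oppr_le0 mulr_ge0 ?sqr_ge0 ?ltW.
Qed.
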